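(* Let $\mathcal{A}$ be a commutative unital $\mathbb{R}$-algebra, let $\mathcal{S}$ be an Archimedean semiring of $\mathcal{A}$ and let $\mathcal{C}\subseteq\mathcal{A}$ be an $\mathcal{S}$-module. Then $\mathcal{C}^\dagger$ is an Archimedean quadratic module of $\mathcal{A}$, and $\mathcal{S}^\dagger$ is a preordering of $\mathcal{A}$.
   Context: Let $\mathcal{A}$ be a commutative unital $\mathbb{R}$-algebra with unit $1$. A convex cone in $\mathcal{A}$ is a non-empty subset $\mathcal{C}$ with $\mathcal{C}+\mathcal{C}\subseteq\mathcal{C}$ and $\lambda\mathcal{C}\subseteq\mathcal{C}$ for all real $\lambda\ge 0$. A convex cone $\mathcal{C}$ is called: a quadratic module if $1\in\mathcal{C}$ and $a^2b\in\mathcal{C}$ for all $b\in\mathcal{C}$, $a\in\mathcal{A}$; a semiring if $1\in\mathcal{C}$ and $\mathcal{C}\cdot\mathcal{C}\subseteq\mathcal{C}$; a preordering if it is both a quadratic module and a semiring. If $\mathcal{S}$ is a semiring of $\mathcal{A}$, an $\mathcal{S}$-module is a convex cone $\mathcal{C}$ with $1\in\mathcal{C}$ and $ac\in\mathcal{C}$ for all $a\in\mathcal{S}$, $c\in\mathcal{C}$. A convex cone $\mathcal{C}$ with $1\in\mathcal{C}$ is Archimedean if for every $a\in\mathcal{A}$ there is $\lambda\in(0,\infty)$ with $\lambda 1-a\in\mathcal{C}$ and $\lambda 1+a\in\mathcal{C}$. For a convex cone $\mathcal{C}$ with $1\in\mathcal{C}$, define $\mathcal{C}^\dagger:=\{a\in\mathcal{A}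 : \text{there exists } c\in\mathcal{C} \text{ such that } a+\epsilon c\in\mathcal{C} \text{ for all } \epsilon\in(0,\infty)\}$. *)

(* Defs.v *)
From HB Require Import structures.
From mathcomp Require Import all_boot all_order all_algebra.
From mathcomp Require Import classical_sets reals.

Set Implicit Arguments.
Unset Strict Implicit.
Unset Printing Implicit Defensive.

Import Order.TTheory GRing.Theory Num.Theory.
Local Open Scope ring_scope.
Local Open Scope classical_set_scope.

(* A commutative unital R-algebra: a commutative ring with a unital ring
   morphism from R.  MathComp's comAlgType requires 1 != 0; this record also
   covers the zero algebra. *)
Record commAlgebra (R : pzRingType) := CommAlgebra {
  alg_ring :> comPzRingType;
  alg_map : {rmorphism R -> alg_ring}
}.

Definition smul {R : pzRingType} {A : commAlgebra R} (l : R) (a : A) : A :=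
  alg_map A l * a.

Definition commAlgebra_of (R : nzRingType) (A : comAlgType R) :
  commAlgebra R := @CommAlgebra R A (in_alg A).

Lemma smul_commAlgebra_of (R : nzRingType) (A : comAlgType R) (l : R)
  (a : commAlgebra_of A) : smul l a = l *: (a : A).
Proof. by rewrite /smul /= mulr_algl. Qed.

Section Cones.
Context {R : realType} {A : commAlgebra R}.
Implicit Types S C : set A.

Definition convex_cone C : Prop :=
  [/\ C !=set0,
      forall a b, C a -> C b -> C (a + b) &
      forall (l : R) a, 0 <= l -> C a -> C (smul l a)].

Definition quadratic_module C : Prop :=
  [/\ convex_cone C, C 1 & forall a b, C b -> C (a ^+ 2 * b)].

Definition semiring C : Prop :=
  [/\ convex_cone C, C 1 & forall a b, C a -> C b -> C (a * b)].

Definition preordering C : Prop := quadratic_module C /\ semiring C.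

Definition semiring_module S C : Prop :=
  [/\ convex_cone C, C 1 & forall a c, S a -> C c -> C (a * c)].

Definition archimedean C : Prop :=
  forall a, exists l : R, [/\ 0 < l, C (smul l 1 - a) & C (smul l 1 + a)].

Definition dagger C : set A :=
  [set a | exists2 c, C c & forall e : R, 0 < e -> C (a + smul e c)].

End Cones.

(* Main.v *)
Require Import Defs.
From mathcomp Require Import all_boot all_order all_algebra.
From mathcomp Require Import classical_sets reals.
From mathcomp Require Import ring lra.

(** The heart of the matter is that every square [a ^+ 2] lies in the closure
    [dagger S] of an Archimedean semiring [S].  Choose [l > 0] with [l - a] and
    [l + a] in [S], and think of [a] as a number in [-l, l].  A random walk
    started at [c] whose independent steps are [+l] and [-l], with
    probabilities [(l + a) / 2l] and [(l - a) / 2l], has steps of mean [a] and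
    second moment [l ^+ 2]; hence the square of its position at time [n] has
    expectation [(c + n a) ^+ 2 + n (l ^+ 2 - a ^+ 2)].  Conditioning on the
    first step writes this expectation as a combination of earlier ones with
    coefficients in [S], so it lies in [S] ([expected_sqr_walk]).  For [c = 0],
    dividing by [n (n - 1)] gives [a ^+ 2 + l ^+ 2 / (n - 1)] in [S] for every
    [n >= 2], that is, [a ^+ 2] in [dagger S] ([dagger_sqr]).

    The rest is continuity.  An [S]-module [C] contains [S], so it is
    Archimedean, and the perturbation [e c] in the definition of [dagger C]
    may be replaced by the constant [e] ([dagger_constP]).  Expanding
    [(s + e) (b + e)] then shows [dagger S * dagger C <= dagger C]
    ([dagger_mul]).  With squares in [dagger S] this makes [dagger C] a
    quadratic module, and with [C = S] it makes [dagger S] multiplicative. *)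

Set Implicit Arguments.
Unset Strict Implicit.
Unset Printing Implicit Defensive.

Import Order.TTheory GRing.Theory Num.Theory.
Local Open Scope ring_scope.
Local Open Scope classical_set_scope.

Section Dagger.
Context {R : realType} {A : commAlgebra R}.
Implicit Types (S C : set A) (a b s x : A) (l e : R).

Lemma smul1 l : smul l (1 : A) = alg_map A l.
Proof. by rewrite /smul mulr1. Qed.

Lemma smulK l a : l != 0 -> smul l^-1 (alg_map A l * a) = a.
Proof. by move=> l0; rewrite /smul mulrA -rmorphM mulVf// rmorph1 mul1r. Qed.

Lemma cone_const C l : convex_cone C -> C 1 -> 0 <= l -> C (alg_map A l).
Proof. by move=> [_ _ CZ] C1 l0; rewrite -smul1; exact: CZ. Qed.

Lemma cone_divr C l a :
  convex_cone C -> 0 < l -> C (alg_map A l * a) -> C a.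
Proof.
move=> [_ _ CZ] l0 Cla; rewrite -(@smulK l a) ?gt_eqF//.
by apply: CZ => //; rewrite invr_ge0 ltW.
Qed.

Lemma sub_dagger C : convex_cone C -> C `<=` dagger C.
Proof.
by move=> [_ CD CZ] a Ca; exists a => // e e0; apply/CD/CZ/Ca => //; exact: ltW.
Qed.

Lemma dagger_convex_cone C : convex_cone C -> convex_cone (dagger C).
Proof.
move=> Cc; have [[c Cc0] CD CZ] := Cc; split.
- by exists c; exact: sub_dagger.
- move=> a b [x Cx ax] [y Cy bY]; exists (x + y); first exact: CD.
  move=> e e0; have -> : a + b + smul e (x + y) =
    (a + smul e x) + (b + smul e y) by rewrite /smul; ring.
  by apply: CD; [exact: ax|exact: bY].
- move=> l a l0 [x Cx ax]; exists (smul l x); first exact: CZ.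
  move=> e e0; have -> : smul l a + smul e (smul l x) =
    smul l (a + smul e x) by rewrite /smul; ring.
  by apply: CZ => //; exact: ax.
Qed.

(** In an Archimedean cone every element [c] is dominated by a constant, so
    all perturbations [e c] may be taken constant. *)
Lemma dagger_constP C a : convex_cone C -> C 1 -> archimedean C ->
  dagger C a <-> forall e, 0 < e -> C (a + alg_map A e).
Proof.
move=> [_ CD CZ] C1 Carch; split=> [[c _ ac] e e0|aC]; last first.
  by exists 1 => // e e0; rewrite smul1; exact: aC.
have [l [l0 lc _]] := Carch c.
have d0 : 0 < e / l by exact: divr_gt0.
have -> : a + alg_map A e =
    (a + smul (e / l) c) + smul (e / l) (smul l 1 - c).
  by rewrite -[in LHS](divfK (lt0r_neq0 l0) e) /smul; ring.
by apply: CD; [exact: ac|apply: CZ => //; exact: ltW].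
Qed.

Lemma semiring_module_self S : semiring S -> semiring_module S S.
Proof. by []. Qed.

Lemma semiring_module_sub S C : semiring_module S C -> S `<=` C.
Proof. by move=> [_ C1 CM] a Sa; rewrite -(mulr1 a); exact: CM. Qed.

Lemma sub_archimedean C D : C `<=` D -> archimedean C -> archimedean D.
Proof.
move=> CD Carch a; have [l [l0 lB lD]] := Carch a.
by exists l; split=> //; exact: CD.
Qed.

(** The element is the expected squared position, after [n] steps, of a walk
    that starts at [c] and moves by [+l] or [-l] with mean step [a].  The start
    [c] is arbitrary because the induction conditions on the first step. *)
Lemma expected_sqr_walk S l a (n : nat) (c : R) : semiring S -> 0 < l ->
    S (alg_map A l - a) -> S (alg_map A l + a) ->
  S ((alg_map A c + n%:R * a) ^+ 2 + n%:R * (alg_map A l ^+ 2 - a ^+ 2)).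
Proof.
move=> [Sc S1 SM] l0 Slm Slp; have [_ SD _] := Sc.
elim: n c => [|n IHn] c.
  rewrite !mul0r !addr0 -rmorphXn.
  by apply: cone_const => //; exact: sqr_ge0.
apply: (@cone_divr _ (2 * l)) => //; first by rewrite mulr_gt0.
(* The two summands are the conditional expectations after a first step up and
   a first step down, weighted by 2l times their probabilities. *)
have := SD _ _ (SM _ _ Slp (IHn (c + l))) (SM _ _ Slm (IHn (c - l))).
by congr S; ring.
Qed.

Lemma dagger_sqr S a : semiring S -> archimedean S -> dagger S (a ^+ 2).
Proof.
move=> Ssr Sarch; have [Sc S1 _] := Ssr; have [_ SD _] := Sc.
apply/dagger_constP => // e e0.
have [l [l0 + +]] := Sarch a; rewrite smul1 => Slm Slp.
pose n := (Num.truncn (l ^+ 2 / e)).+1.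
have nl : l ^+ 2 <= e * n%:R.
  by rewrite mulrC -ler_pdivrMr// ltW// truncnS_gt.
have n0 : 0 < n%:R :> R by rewrite ltr0n.
apply: (@cone_divr _ (n.+1%:R * n%:R)) => //; first by rewrite mulr_gt0 ?ltr0n.
(* At time n + 1 the walk from 0 yields n (n + 1) a^2 + (n + 1) l^2. *)
have := expected_sqr_walk n.+1 0 Ssr l0 Slm Slp.
have c0 : 0 <= n.+1%:R * (e * n%:R - l ^+ 2) by rewrite mulr_ge0// subr_ge0.
move=> /SD /(_ (cone_const Sc S1 c0)).
by congr S; ring.
Qed.

Lemma dagger_mul S C s b : semiring S -> archimedean S ->
  semiring_module S C -> dagger S s -> dagger C b -> dagger C (s * b).
Proof.
move=> [Sc S1 _] Sarch Cmod; have [Cc C1 CM] := Cmod; have [_ CD CZ] := Cc.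
have Carch := sub_archimedean (semiring_module_sub Cmod) Sarch.
move=> /(dagger_constP _ Sc S1 Sarch) sS /(dagger_constP _ Cc C1 Carch) bC.
apply/dagger_constP => // e e0.
have [l [l0 lsb _]] := Carch (s + b).
(* Since (s + d) (b + d) <= s b + d l + d^2, it suffices that
   d (l + d) <= e, which holds as soon as d <= 1 and d (l + 1) <= e. *)
pose d := e / (l + 1 + e).
have p0 : 0 < l + 1 + e by lra.
have d0 : 0 < d by exact: divr_gt0.
have dE : d * (l + 1 + e) = e by rewrite /d divfK ?lt0r_neq0.
have d1 : d <= 1 by rewrite ler_pdivrMr// mul1r; lra.
have r0 : 0 <= e - d * l - d ^+ 2 by nra.
have := CD _ _ (CD _ _ (CM _ _ (sS d d0) (bC d d0)) (CZ d _ (ltW d0) lsb))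
  (cone_const Cc C1 r0).
by congr C; rewrite /smul; ring.
Qed.

Lemma dagger_quadratic_module S C : semiring S -> archimedean S ->
  semiring_module S C -> quadratic_module (dagger C).
Proof.
move=> Ssr Sarch Cmod; have [Cc C1 _] := Cmod; split.
- exact: dagger_convex_cone.
- exact: sub_dagger.
- by move=> a b; exact: dagger_mul Ssr Sarch Cmod (dagger_sqr a Ssr Sarch).
Qed.

Lemma dagger_semiring S : semiring S -> archimedean S -> semiring (dagger S).
Proof.
move=> Ssr Sarch; have [Sc S1 _] := Ssr; split.
- exact: dagger_convex_cone.
- exact: sub_dagger.
- by move=> a b; exact: dagger_mul Ssr Sarch (semiring_module_self Ssr).
Qed.

End Dagger.

Theorem theorem3p2 (R : realType) (A : commAlgebra R) (S C : set A)
    (hS : semiring S) (hSarch : archimedean S) (hC : semiring_module S C) :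
  (quadratic_module (dagger C) /\ archimedean (dagger C)) /\
  preordering (dagger S).
Proof.
have [Cc _ _] := hC.
split; split.
- exact: dagger_quadratic_module hS hSarch hC.
- apply: sub_archimedean hSarch.
  exact: subset_trans (semiring_module_sub hC) (sub_dagger Cc).
- exact: dagger_quadratic_module hS hSarch (semiring_module_self hS).
- exact: dagger_semiring.
Qed.
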